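(* Let $f=(f_n)_{n\in\mathbb{N}}$ be a real sequence with $f_0=0$ and $f_n>0$ for all $n\geq 1$. Then for any real sequence $V=(V_n)_{n\geq 1}$ and any $u\in C_c(\mathbb{N})$ with $u_0=0$, there holds $$\sum_{n=1}^\infty V_n|\nabla u_n|^2 + \sum_{n=1}^\infty \frac{\mathrm{div}(V\nabla f)_n}{f_n}\, u^2_n =\sum_{n=2}^\infty V_n\left|\sqrt{\frac{f_{n-1}}{f_n}}\,u_n - \sqrt{\frac{f_n}{f_{n-1}}}\,u_{n-1}\right|^2.$$
   Context: $\mathbb{N}=\{0,1,2,\dots\}$, $C_c(\mathbb{N})$ is the space of finitely supported real sequences $u=(u_n)_{n\in\mathbb{N}}$. The discrete gradient is $\nabla u_n = u_n-u_{n-1}$ for $n\geq 1$ and the discrete divergence is $\mathrm{div}(u)_n = u_{n+1}-u_n$; thus for $n\ge 1$, $\mathrm{div}(V\nabla f)_n = V_{n+1}(f_{n+1}-f_n)-V_n(f_n-f_{n-1})$. *)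

(* Defs.v *)
From mathcomp Require Import all_boot all_order all_algebra.
From mathcomp Require Import boolp classical_sets functions cardinality reals.
From mathcomp Require Import topology normedtype sequences.

Set Implicit Arguments.
Unset Strict Implicit.
Unset Printing Implicit Defensive.

Import Order.TTheory GRing.Theory Num.Theory.
Import numFieldNormedType.Exports.

Local Open Scope classical_set_scope.
Local Open Scope ring_scope.

(* Only meaningful for n >= 1; at n = 0 it takes the value 0 since 0.-1 = 0. *)
Definition dgrad (R : realType) (u : nat -> R) (n : nat) : R := u n - u n.-1.

Definition ddiv (R : realType) (u : nat -> R) (n : nat) : R := u n.+1 - u n.

Definition finitely_supported (R : realType) (u : nat -> R) : Prop :=
  finite_set [set n | u n != 0].

(* Main.v *)
(** Expanding the square with [sqrt (a/b) * sqrt (b/a) = 1] gives, term by term,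
    V_n|∇u_n|² + (div(V∇f)_n / f_n) u_n² = (n-th square) + B_n - B_{n-1},
    with B_n = V_{n+1} (f_{n+1} - f_n) u_n² / f_n. So the partial sums differ by the
    boundary term B_N, which vanishes beyond the support of u. *)
Require Import Defs.
From mathcomp Require Import all_boot all_order all_algebra.
From mathcomp Require Import boolp classical_sets functions cardinality reals.
From mathcomp Require Import topology normedtype sequences.
From mathcomp Require Import ring.

Import Order.TTheory GRing.Theory Num.Theory.
Import numFieldNormedType.Exports.

Local Open Scope classical_set_scope.
Local Open Scope ring_scope.

Lemma finitely_supported_eventually0 (R : realType) (u : nat -> R) :
  finitely_supported u -> exists N, forall n, (N <= n)%N -> u n = 0.
Proof.
(* The list [s] enumerates the support, so one past its largest entry is a valid cutoff. *)
move=> /finite_seqP[s us]; exists (\max_(i <- s) i).+1 => n sn.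
apply/eqP; apply: contraTT sn => un0; rewrite -leqNgt.
have ns : n \in s by have : [set n | u n != 0] n by []; rewrite us.
exact: leq_bigmax_seq.
Qed.

(** The partial sums are constant from [N] on, so they converge to that constant. *)
Lemma series_eventually0 (R : realType) (a : nat -> R) (m N : nat) :
  (m <= N)%N -> (forall n, (N <= n)%N -> a n = 0) ->
  \big[+%R/0]_(m <= n <oo) a n = \sum_(m <= n < N) a n.
Proof.
move=> mN a0; apply: cvg_lim => //; apply: cvg_near_cst.
exists N => // k /= Nk; rewrite (big_cat_nat mN Nk) /=.
rewrite [X in _ + X]big1_seq ?addr0// => n.
by rewrite mem_index_iota => /andP[_ /andP[/a0]].
Qed.

Lemma sqr_sqrt_ratio_sub (R : realType) (a b x y : R) : 0 < a -> 0 < b ->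
  `|Num.sqrt (a / b) * x - Num.sqrt (b / a) * y| ^+ 2
  = a / b * x ^+ 2 + b / a * y ^+ 2 - x * y *+ 2.
Proof.
move=> a0 b0; rewrite real_normK ?num_real// sqrrB !exprMn.
rewrite !sqr_sqrtr ?divr_ge0 ?ltW// (mulrACA (Num.sqrt _)) -sqrtrM ?divr_ge0 ?ltW//.
have -> : a / b * (b / a) = 1 by field; rewrite !gt_eqF.
by rewrite sqrtr1 mul1r addrAC.
Qed.

Lemma partial_sum_ground_state (R : realType) (f V u : nat -> R) (N : nat) :
  f 0%N = 0 -> (forall n, (1 <= n)%N -> 0 < f n) -> u 0%N = 0 ->
  \sum_(1 <= n < N.+2) V n * `|dgrad u n| ^+ 2
    + \sum_(1 <= n < N.+2) ddiv (fun k => V k * dgrad f k) n / f n * u n ^+ 2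
  = \sum_(2 <= n < N.+2)
      V n * `|Num.sqrt (f n.-1 / f n) * u n
               - Num.sqrt (f n / f n.-1) * u n.-1| ^+ 2
    + V N.+2 * (f N.+2 - f N.+1) / f N.+1 * u N.+1 ^+ 2.
Proof.
move=> f0 f_gt0 u0.
have f_neq0 n : f n.+1 != 0 by rewrite gt_eqF// f_gt0.
elim: N => [|N IH].
  (* The sum of squares is empty. As [f 0 = u 0 = 0], the gradient term [V 1 * u 1 ^+ 2] cancels
     against the [V 1] part of the divergence term, leaving only the boundary term. *)
  rewrite !big_nat1 big_geq// real_normK ?num_real// /ddiv /dgrad /= f0 u0.
  by field.
rewrite (big_nat_recr N.+2)//= [in X in _ + X](big_nat_recr N.+2)//= addrACA IH.
rewrite [in RHS](big_nat_recr N.+2)//= -!addrA; congr (_ + _).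
(* What remains is the one-term identity at [n = N.+2], where the old boundary term supplies the
   missing multiple of [u n.-1 ^+ 2]. *)
rewrite sqr_sqrt_ratio_sub ?f_gt0// real_normK ?num_real// /ddiv /dgrad /=.
by field; rewrite !f_neq0.
Qed.

Theorem mainTheorem5 (R : realType) (f : nat -> R)
    (f0 : f 0%N = 0) (f_gt0 : forall n : nat, (1 <= n)%N -> 0 < f n)
    (V u : nat -> R) (u_fin : finitely_supported u) (u0 : u 0%N = 0) :
  \big[+%R/0]_(1 <= n <oo) (V n * `|dgrad u n| ^+ 2)
    + \big[+%R/0]_(1 <= n <oo)
        (ddiv (fun k => V k * dgrad f k) n / f n * u n ^+ 2)
  = \big[+%R/0]_(2 <= n <oo)
      (V n * `|Num.sqrt (f n.-1 / f n) * u n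
               - Num.sqrt (f n / f n.-1) * u n.-1| ^+ 2).
Proof.
have [N uN] := finitely_supported_eventually0 _ _ u_fin.
(* Gradient and square at [n] also involve [u n.-1], so the cutoff lies beyond [N]; [N.+2] also fits
   the sum starting at 2 and the partial-sum identity. *)
have uNS n : (N.+2 <= n)%N -> u n = 0 /\ u n.-1 = 0.
  by case: n => // n Nn; rewrite !uN//= ltnW// ltnW.
rewrite !(@series_eventually0 _ _ _ N.+2)//; last 3 first.
- by move=> n /uNS[un un1]; rewrite un un1 !mulr0 subrr normr0 expr0n mulr0.
- by move=> n /uNS[un _]; rewrite un expr0n mulr0.
- by move=> n /uNS[un un1]; rewrite /dgrad un un1 subrr normr0 expr0n mulr0.
by rewrite partial_sum_ground_state// uN// expr0n mulr0 addr0.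
Qed.
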